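(* Let $m=\prod_{i=1}^s p_i^{k_i}$ be the prime factorization of $m$, $R_m=\mathbb{Z}/m\mathbb{Z}$, $R_i=\mathbb{Z}/p_i^{k_i}\mathbb{Z}$, and $\Theta:R_m\xrightarrow{\sim}\prod_{i=1}^s R_i$ the Chinese Remainder isomorphism. Assume $F:R_m\to R_m$ is congruence-preserving, so that it decomposes componentwise into maps $F_i:R_i\to R_i$ via $$F=\Theta^{-1}\circ(F_1\times\cdots\times F_s)\circ\Theta.$$ For each $i$ let $\pi_i^{(k_i)}:\mathbb{Z}_{p_i}\to R_i$ be the reduction map (with $\mathbb{Z}_{p_i}/p_i^{k_i}\mathbb{Z}_{p_i}\cong R_i$). Suppose there exist maps (rational or analytic; no analytic hypothesis is needed) $\phi_i:\mathbb{Z}_{p_i}\to\mathbb{Z}_{p_i}$ such that $$\pi_i^{(k_i)}\circ\phi_i=F_i\circ\pi_i^{(k_i)}\quad\text{on }\mathbb{Z}_{p_i}.$$ Define $\Omega:=\prod_{i=1}^s\mathbb{Z}_{p_i}$, $\Phi:=\prod_{i=1}^s\phi_i:\Omega\to\Omega$, and $$\Pi:=\Theta^{-1}\circ(\pi_1^{(k_1)}\times\cdots\times\pi_s^{(k_s)}):\Omega\to R_m.$$ Then $\Pi\circ\Phi=F\circ\Pi$; that is, $\Phi$ interprets $F$ with inclusion on $\Omega$.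
   Context: A map of sets $F:\mathbb{Z}/m\mathbb{Z}\to\mathbb{Z}/m\mathbb{Z}$ is congruence-preserving if for every divisor $d\mid m$ and all $x,y$, $x\equiv y\pmod d$ implies $F(x)\equiv F(y)\pmod d$. ''$\Phi$ interprets $F$ with inclusion on $\Omega$'' means that $\Phi(\Pi^{-1}(x))\subseteq\Pi^{-1}(F(x))$ for every $x\in R_m$, equivalently $\Pi\circ\Phi=F\circ\Pi$. *)

(* Defs.v *)
From HB Require Import structures.
From mathcomp Require Import all_boot all_order all_algebra.
From mathcomp Require Import boolp classical_sets.

Set Implicit Arguments.
Unset Strict Implicit.
Unset Printing Implicit Defensive.

Import GRing.Theory.

Local Open Scope ring_scope.

(* [Zmod m] is Z/mZ for every m >= 1, the zero ring Z/1Z included; MathComp's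
   ['Z_m] is Z/2Z when m = 1. The elements are the representatives
   0, ..., m - 1. *)
Definition Zmod (m : nat) : Type := 'I_m.-1.+1.

HB.instance Definition _ (m : nat) := Finite.copy (Zmod m) 'I_m.-1.+1.
HB.instance Definition _ (m : nat) := GRing.Zmodule.copy (Zmod m) 'I_m.-1.+1.

Definition Zrep (m : nat) (x : Zmod m) : nat := nat_of_ord x.

Definition Zclass (m a : nat) : Zmod m := inZp a.

Lemma Zmod_mulDl (m : nat) :
  left_distributive (@Zp_mul m.-1.+1 : Zmod m -> Zmod m -> Zmod m) +%R.
Proof. exact: Zp_mul_addl. Qed.

HB.instance Definition _ (m : nat) :=
  GRing.Zmodule_isComPzRing.Build (Zmod m)
    (@Zp_mulA m.-1.+1) (@Zp_mulC m.-1.+1) (@Zp_mul1z m.-1) (@Zmod_mulDl m).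

Lemma Zrep_inj (m : nat) : injective (@Zrep m).
Proof. exact: val_inj. Qed.

Lemma ltn_Zrep (m : nat) (x : Zmod m) : (0 < m)%N -> (Zrep x < m)%N.
Proof. by move=> m0; rewrite -[X in (_ < X)%N](prednK m0) ltn_ord. Qed.

Lemma ZrepK (m : nat) : cancel (@Zrep m) (@Zclass m).
Proof. exact: valZpK. Qed.

Lemma ZclassK (m a : nat) : (0 < m)%N -> Zrep (Zclass m a) = (a %% m)%N.
Proof. by move=> m0; rewrite /Zrep /= prednK. Qed.

Lemma eq_Zclass (m a b : nat) :
  (0 < m)%N -> a = b %[mod m] -> Zclass m a = Zclass m b.
Proof. by move=> m0 e; apply: Zrep_inj; rewrite !ZclassK. Qed.

Lemma ZclassD (m a b : nat) : Zclass m (a + b) = Zclass m a + Zclass m b.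
Proof. by apply: val_inj; rewrite /= modnDm. Qed.

Lemma ZclassM (m a b : nat) : Zclass m (a * b) = Zclass m a * Zclass m b.
Proof. by apply: val_inj; rewrite /= modnMm. Qed.

Lemma Zclass1 (m : nat) : Zclass m 1 = 1.
Proof. exact: val_inj. Qed.

Lemma Zclass_nat (m a : nat) : Zclass m a = a%:R.
Proof.
elim: a => [|a IHa]; first by apply: val_inj; rewrite /= mod0n.
by rewrite -addn1 ZclassD IHa Zclass1 natrD.
Qed.

(* The reduction Z/mZ -> Z/dZ; it is well defined on classes if d divides m. *)
Definition Zred (m d : nat) (x : Zmod m) : Zmod d := Zclass d (Zrep x).

Arguments Zred {m} d x.

Lemma Zred_class (m d a : nat) :
  (0 < m)%N -> (d %| m)%N -> Zred d (Zclass m a) = Zclass d a.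
Proof.
move=> m0 dm; rewrite /Zred ZclassK //; apply: eq_Zclass.
  exact: dvdn_gt0 m0 dm.
by rewrite modn_dvdm.
Qed.

Lemma Zred_nat (m d a : nat) :
  (0 < m)%N -> (d %| m)%N -> Zred d (a%:R : Zmod m) = a%:R.
Proof. by move=> m0 dm; rewrite -!Zclass_nat Zred_class. Qed.

Lemma ZredD (m d : nat) (x y : Zmod m) :
  (0 < m)%N -> (d %| m)%N -> Zred d (x + y) = Zred d x + Zred d y.
Proof.
by move=> m0 dm; rewrite -{1}(ZrepK x) -{1}(ZrepK y) -ZclassD Zred_class //
  ZclassD.
Qed.

Lemma ZredM (m d : nat) (x y : Zmod m) :
  (0 < m)%N -> (d %| m)%N -> Zred d (x * y) = Zred d x * Zred d y.
Proof.
by move=> m0 dm; rewrite -{1}(ZrepK x) -{1}(ZrepK y) -ZclassM Zred_class //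
  ZclassM.
Qed.

Lemma Zred1 (m d : nat) :
  (0 < m)%N -> (d %| m)%N -> Zred d (1 : Zmod m) = 1.
Proof. by move=> m0 dm; rewrite -!Zclass1 Zred_class. Qed.

Lemma Zred0 (m d : nat) : Zred d (0 : Zmod m) = 0.
Proof. by apply: val_inj; rewrite /= mod0n. Qed.

Lemma ZredN (m d : nat) (x : Zmod m) :
  (0 < m)%N -> (d %| m)%N -> Zred d (- x) = - Zred d x.
Proof.
by move=> m0 dm; apply/eqP; rewrite -addr_eq0 -ZredD // addNr Zred0.
Qed.

(* For d dividing m, the relation "x = y mod d" on Z/mZ may be read on the
   representatives. *)
Definition congruence_preserving (m : nat) (F : Zmod m -> Zmod m) : Prop :=
  forall d : nat, (d %| m)%N -> forall x y : Zmod m,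
    Zrep x = Zrep y %[mod d] -> Zrep (F x) = Zrep (F y) %[mod d].

Definition prime_factorization (m s : nat) (p k : 'I_s -> nat) : Prop :=
  [/\ forall i, prime (p i), injective p, forall i, (0 < k i)%N
    & m = (\prod_(i < s) p i ^ k i)%N].

Definition prod_map (I : Type) (A B : I -> Type) (f : forall i, A i -> B i)
  (x : forall i, A i) : forall i, B i := fun i => f i (x i).

Section ChineseRemainder.
Variables (m s : nat) (p k : 'I_s -> nat).

Definition crt (x : Zmod m) : forall i, Zmod (p i ^ k i) :=
  fun i => Zred (p i ^ k i) x.

(* The unique x such that [crt x = y] when the [p i ^ k i] are the prime power
   factors of m, see [crtK] and [crt_invK]; the default value is then unused. *)
Definition crt_inv (y : forall i, Zmod (p i ^ k i)) : Zmod m :=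
  odflt 0 [pick x : Zmod m | [forall i, crt x i == y i]].

Hypothesis mpk : prime_factorization m p k.

Lemma factor_gt0 i : (0 < p i ^ k i)%N.
Proof. by case: mpk => pr _ _ _; rewrite expn_gt0 prime_gt0. Qed.

Lemma factor_dvd i : (p i ^ k i %| m)%N.
Proof. by case: mpk => _ _ _ ->; rewrite (bigD1 i) //= dvdn_mulr. Qed.

Lemma modulus_gt0 : (0 < m)%N.
Proof.
by case: mpk => _ _ _ ->; rewrite prodn_cond_gt0 // => i _; apply: factor_gt0.
Qed.

Lemma factor_coprime i j : i != j -> coprime (p i ^ k i) (p j ^ k j).
Proof.
case: mpk => pr injp _ _ ij; apply/coprimeXl/coprimeXr.
by rewrite prime_coprime // dvdn_prime2 // (inj_eq injp).
Qed.

Lemma coprime_prodr a (r : seq 'I_s) :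
  (forall j, j \in r -> coprime a (p j ^ k j)) ->
  coprime a (\prod_(j <- r) p j ^ k j)%N.
Proof.
move=> co; rewrite big_seq; elim/big_rec: _ => [|j n /co cj cn].
  exact: coprimen1.
by rewrite coprimeMr cj.
Qed.

Lemma crtD x y i : crt (x + y) i = crt x i + crt y i.
Proof. by rewrite /crt ZredD ?modulus_gt0 ?factor_dvd. Qed.

Lemma crtM x y i : crt (x * y) i = crt x i * crt y i.
Proof. by rewrite /crt ZredM ?modulus_gt0 ?factor_dvd. Qed.

Lemma crt1 i : crt 1 i = 1.
Proof. by rewrite /crt Zred1 ?modulus_gt0 ?factor_dvd. Qed.

Lemma crt_inj x y : (forall i, crt x i = crt y i) -> x = y.
Proof.
move=> exy; apply: Zrep_inj.
wlog lexy : x y exy / (Zrep y <= Zrep x)%N.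
  move=> W; have [|/ltnW h] := leqP (Zrep y) (Zrep x); first exact: W.
  by apply/esym/W.
suff dv : (m %| Zrep x - Zrep y)%N.
  apply/eqP; rewrite eqn_leq lexy andbT -subn_eq0; apply/eqP.
  have := modn_small (leq_ltn_trans (leq_subr _ _) (ltn_Zrep x modulus_gt0)).
  by move=> /(_ (Zrep y)) <-; apply/eqP.
have dvdi i : (p i ^ k i %| Zrep x - Zrep y)%N.
  rewrite -eqn_mod_dvd //; apply/eqP.
  by have := congr1 (@Zrep _) (exy i); rewrite /crt /Zred !ZclassK ?factor_gt0.
move: dvdi; move: (_ - _)%N => a dvdi.
have -> : m = (\prod_(i <- index_enum 'I_s) p i ^ k i)%N by case: mpk.
elim: (index_enum _) (index_enum_uniq 'I_s) => [|i r IHr] /= => [_|].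
  by rewrite big_nil dvd1n.
case/andP=> ir /IHr dvdr; rewrite big_cons Gauss_dvd ?dvdi //.
apply: coprime_prodr => j jr; apply: factor_coprime.
by apply: contraNneq ir => ->.
Qed.

Lemma crt_surj (y : forall i, Zmod (p i ^ k i)) : exists x, forall i, crt x i = y i.
Proof.
suff [a ea] : exists a : nat, forall i, i \in index_enum 'I_s ->
    a = Zrep (y i) %[mod p i ^ k i].
  exists (Zclass m a) => i; rewrite /crt Zred_class ?modulus_gt0 ?factor_dvd //.
  by rewrite -[RHS]ZrepK; apply: eq_Zclass; rewrite ?factor_gt0 ?ea ?mem_index_enum.
elim: (index_enum _) (index_enum_uniq 'I_s) => [|i r IHr] /= => [_|].
  by exists 0%N.
case/andP=> ir /IHr[a ea].
have co : coprime (p i ^ k i) (\prod_(j <- r) p j ^ k j)%N.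
  apply: coprime_prodr => j jr; apply: factor_coprime.
  by apply: contraNneq ir => ->.
exists (chinese (p i ^ k i) (\prod_(j <- r) p j ^ k j)%N (Zrep (y i)) a) => j.
rewrite inE => /predU1P[->|jr]; first exact: chinese_modl.
rewrite -(ea j jr).
have dv : (p j ^ k j %| \prod_(j <- r) p j ^ k j)%N.
  by rewrite (big_rem j) //= dvdn_mulr.
by rewrite -(modn_dvdm _ dv) chinese_modr // modn_dvdm.
Qed.

Lemma crt_invK (y : forall i, Zmod (p i ^ k i)) i : crt (crt_inv y) i = y i.
Proof.
rewrite /crt_inv; case: pickP => [x /forallP/(_ i)/eqP //|nox].
have [x ex] := crt_surj y.
by have/negP[] := negbT (nox x); apply/forallP => j; rewrite ex.
Qed.

Lemma crtK : cancel crt crt_inv.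
Proof. by move=> x; apply: crt_inj => i; rewrite crt_invK. Qed.

End ChineseRemainder.

(* The p-adic integers, as the inverse limit of the rings Z/p^nZ. *)
Record padic_int (p : nat) := PadicInt {
  padic_seq : forall n : nat, Zmod (p ^ n);
  padic_seqP : forall n : nat, Zred (p ^ n) (padic_seq n.+1) = padic_seq n
}.

Definition padic_red (p n : nat) (x : padic_int p) : Zmod (p ^ n) :=
  padic_seq x n.

Section PadicRing.
Variable p : nat.
Implicit Types x y z : padic_int p.

Lemma padic_eqP x y : (forall n, padic_red n x = padic_red n y) -> x = y.
Proof.
case: x y => [x xP] [y yP] /= exy.
have {}exy : x = y by apply/functional_extensionality_dep.
by rewrite exy in xP *; congr PadicInt; apply: Prop_irrelevance.
Qed.

Let Zmod0_eq n (a b : Zmod (0 ^ n)) : a = b.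
Proof.
have e (u v : 'I_1) : u = v by rewrite !ord1.
by case: n a b => [|n] a b; [exact: e | apply: val_inj => /=;
  case: a b => [a a0] [b b0] /=; move: a0 b0; rewrite exp0n //; case: a; case: b].
Qed.

Let redD n (a b : Zmod (p ^ n.+1)) :
  Zred (p ^ n) (a + b) = Zred (p ^ n) a + Zred (p ^ n) b.
Proof.
have [p0|p0] := posnP p; last by rewrite ZredD ?expn_gt0 ?p0 ?dvdn_exp2l.
by move: a b; rewrite p0 => a b; apply: Zmod0_eq.
Qed.

Let redM n (a b : Zmod (p ^ n.+1)) :
  Zred (p ^ n) (a * b) = Zred (p ^ n) a * Zred (p ^ n) b.
Proof.
have [p0|p0] := posnP p; last by rewrite ZredM ?expn_gt0 ?p0 ?dvdn_exp2l.
by move: a b; rewrite p0 => a b; apply: Zmod0_eq.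
Qed.

Let red1 n : Zred (p ^ n) (1 : Zmod (p ^ n.+1)) = 1.
Proof.
have [p0|p0] := posnP p; last by rewrite Zred1 ?expn_gt0 ?p0 ?dvdn_exp2l.
by rewrite p0; apply: Zmod0_eq.
Qed.

Let redN n (a : Zmod (p ^ n.+1)) : Zred (p ^ n) (- a) = - Zred (p ^ n) a.
Proof. by apply/eqP; rewrite -addr_eq0 -redD addNr Zred0. Qed.

Definition padic_zero : padic_int p := PadicInt (fun n => Zred0 _ _).

Definition padic_one : padic_int p := PadicInt red1.

Definition padic_opp x : padic_int p.
Proof.
by exists (fun n => - padic_seq x n) => n; rewrite redN padic_seqP.
Defined.

Definition padic_add x y : padic_int p.
Proof.
by exists (fun n => padic_seq x n + padic_seq y n) => n; rewrite redD !padic_seqP.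
Defined.

Definition padic_mul x y : padic_int p.
Proof.
by exists (fun n => padic_seq x n * padic_seq y n) => n; rewrite redM !padic_seqP.
Defined.

HB.instance Definition _ := gen_eqMixin (padic_int p).
HB.instance Definition _ := gen_choiceMixin (padic_int p).

Lemma padic_addA : associative padic_add.
Proof. by move=> x y z; apply: padic_eqP => n; apply: addrA. Qed.

Lemma padic_addC : commutative padic_add.
Proof. by move=> x y; apply: padic_eqP => n; apply: addrC. Qed.

Lemma padic_add0 : left_id padic_zero padic_add.
Proof. by move=> x; apply: padic_eqP => n; apply: add0r. Qed.

Lemma padic_addN : left_inverse padic_zero padic_opp padic_add.
Proof. by move=> x; apply: padic_eqP => n; apply: addNr. Qed.

HB.instance Definition _ := GRing.isZmodule.Build (padic_int p)
  padic_addA padic_addC padic_add0 padic_addN.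

Lemma padic_mulA : associative padic_mul.
Proof. by move=> x y z; apply: padic_eqP => n; apply: mulrA. Qed.

Lemma padic_mulC : commutative padic_mul.
Proof. by move=> x y; apply: padic_eqP => n; apply: mulrC. Qed.

Lemma padic_mul1 : left_id padic_one padic_mul.
Proof. by move=> x; apply: padic_eqP => n; apply: mul1r. Qed.

Lemma padic_mulDl : left_distributive padic_mul +%R.
Proof. by move=> x y z; apply: padic_eqP => n; apply: mulrDl. Qed.

HB.instance Definition _ := GRing.Zmodule_isComPzRing.Build (padic_int p)
  padic_mulA padic_mulC padic_mul1 padic_mulDl.

Lemma padic_red_is_zmod_morphism n : zmod_morphism (@padic_red p n).
Proof. by []. Qed.

Lemma padic_red_is_monoid_morphism n : monoid_morphism (@padic_red p n).
Proof. by []. Qed.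

HB.instance Definition _ n :=
  GRing.isZmodMorphism.Build (padic_int p) (Zmod (p ^ n)) (@padic_red p n)
    (padic_red_is_zmod_morphism n).
HB.instance Definition _ n :=
  GRing.isMonoidMorphism.Build (padic_int p) (Zmod (p ^ n)) (@padic_red p n)
    (padic_red_is_monoid_morphism n).

Lemma padic_red_surj n (a : Zmod (p ^ n)) : exists x, padic_red n x = a.
Proof.
by exists (Zrep a)%:R; rewrite rmorph_nat -Zclass_nat ZrepK.
Qed.

Hypothesis p_gt0 : (0 < p)%N.

Lemma padic_red_add n j x :
  Zrep (padic_red n x) = (Zrep (padic_red (n + j) x) %% p ^ n)%N.
Proof.
elim: j => [|j ->]; first by rewrite addn0 modn_small // ltn_Zrep // expn_gt0 p_gt0.
rewrite addnS -[padic_red (n + j) x]padic_seqP ZclassK ?expn_gt0 ?p_gt0 //.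
by rewrite modn_dvdm // dvdn_exp2l // leq_addr.
Qed.

(* With [padic_red_surj]: [padic_red n] identifies Z_p / p^n Z_p with Z/p^nZ. *)
Lemma padic_red_eq0 n x :
  padic_red n x = 0 <-> exists y, x = (p ^ n)%:R * y.
Proof.
have pn0 j : (0 < p ^ j)%N by rewrite expn_gt0 p_gt0.
split=> [x0|[y ->]]; last first.
  by rewrite rmorphM rmorph_nat -Zclass_nat (_ : Zclass _ _ = 0) ?mul0r //;
    apply: Zrep_inj; rewrite ZclassK // modnn.
pose q j := (Zrep (padic_red (n + j) x) %/ p ^ n)%N.
have qE j : (q j * p ^ n)%N = Zrep (padic_red (n + j) x).
  by rewrite divnK // /dvdn -padic_red_add x0.
have yP j : Zred (p ^ j) (Zclass (p ^ j.+1) (q j.+1)) = Zclass (p ^ j) (q j).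
  rewrite Zred_class ?dvdn_exp2l //; apply: eq_Zclass => //.
  apply/eqP; rewrite -(eqn_pmul2r (pn0 n)) !muln_modl // !qE -expnD (addnC j).
  by rewrite addnS -addn1 -(padic_red_add _ 1) modn_small // ltn_Zrep.
exists (PadicInt yP); apply: padic_eqP => j.
rewrite rmorphM rmorph_nat /= -Zclass_nat -ZclassM.
apply: Zrep_inj; rewrite ZclassK // mulnC qE addnC -padic_red_add //.
Qed.

End PadicRing.

Local Open Scope classical_set_scope.

Definition interprets_with_inclusion (Omega R : Type) (Pi : Omega -> R)
  (Phi : Omega -> Omega) (F : R -> R) : Prop :=
  forall x : R, Phi @` (Pi @^-1` [set x]) `<=` Pi @^-1` [set F x].

Definition padic_prod_red (m s : nat) (p k : 'I_s -> nat) :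
  (forall i, padic_int (p i)) -> Zmod m :=
  @crt_inv m s p k \o prod_map (fun i => @padic_red (p i) (k i)).

Arguments crt {m s p k} x i.
Arguments crt_inv {m s p k} y.
Arguments padic_prod_red {m s} p k x.

(* Main.v *)
Require Import Defs.
From mathcomp Require Import all_boot all_order all_algebra.
From mathcomp Require Import boolp classical_sets.

Set Implicit Arguments.
Unset Strict Implicit.
Unset Printing Implicit Defensive.

(** An element of Z/mZ is determined by its residues modulo the prime power
    factors of m ([crt_inj]), so every equality in Z/mZ is checked one residue at
    a time.  The residue of F x modulo the i-th factor depends only on that of x,
    because F respects congruence modulo the factor; this gives the component
    [component F i].  For the commutation of Phi and F, the i-th residue of
    Pi (Phi w) is the reduction of phi_i (w_i), that of F (Pi w) is F_i applied to
    the reduction of w_i, and the two agree by the hypothesis on phi_i.  The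
    inclusion between fibres is another form of the commutation
    ([interprets_with_inclusionP]). *)

(** When F is congruence-preserving and [p i ^ k i] divides m, every lift of the
    residue a to Z/mZ gives the same value. *)
Definition component (m s : nat) (p k : 'I_s -> nat) (F : Zmod m -> Zmod m)
    (i : 'I_s) (a : Zmod (p i ^ k i)) : Zmod (p i ^ k i) :=
  Zred (p i ^ k i) (F (Zclass m (Zrep a))).

(** The lift used in [component] is congruent to x modulo [p i ^ k i], since both
    reduce to [crt x i]; F carries this congruence over to their images. *)
Lemma crt_component (m s : nat) (p k : 'I_s -> nat) (F : Zmod m -> Zmod m) :
  prime_factorization m p k -> congruence_preserving F ->
  forall x i, @crt m s p k (F x) i = component F (crt x i).
Proof.
move=> hm hF x i; apply: (eq_Zclass (factor_gt0 hm i)).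
apply: (hF _ (factor_dvd hm i)).
by rewrite !ZclassK ?(modulus_gt0 hm) ?(factor_gt0 hm) //
  (modn_dvdm _ (factor_dvd hm i)) modn_mod.
Qed.

Lemma crt_padic_prod_red (m s : nat) (p k : 'I_s -> nat) :
  prime_factorization m p k ->
  forall w i, crt (@padic_prod_red m s p k w) i = padic_red (k i) (w i).
Proof. by move=> hm w i; rewrite (crt_invK hm). Qed.

Lemma interprets_with_inclusionP (Omega R : Type) (Pi : Omega -> R)
    (Phi : Omega -> Omega) (F : R -> R) :
  interprets_with_inclusion Pi Phi F <-> Pi \o Phi =1 F \o Pi.
Proof.
split=> [incl w | comm _ _ [w /= <- <-]]; last exact: comm.
by apply: (incl (Pi w)); exists w.
Qed.

Theorem proposition7p22 (m s : nat) (p k : 'I_s -> nat)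
    (hm : prime_factorization m p k)
    (F : Zmod m -> Zmod m) (hF : congruence_preserving F) :
  (exists Fi : forall i, Zmod (p i ^ k i) -> Zmod (p i ^ k i),
    F =1 crt_inv \o prod_map Fi \o crt) /\
  (forall Fi : forall i, Zmod (p i ^ k i) -> Zmod (p i ^ k i),
    F =1 crt_inv \o prod_map Fi \o crt ->
    forall phi : forall i, padic_int (p i) -> padic_int (p i),
    (forall i, padic_red (k i) \o phi i =1 Fi i \o padic_red (k i)) ->
    let Phi := prod_map phi in
    let Pi := padic_prod_red p k in
    Pi \o Phi =1 F \o Pi /\ interprets_with_inclusion Pi Phi F).
Proof.
split=> [|Fi FE phi phiE Phi Pi].
  exists (component F) => x; apply: (crt_inj hm) => i.
  by rewrite (crt_invK hm) (crt_component hm hF).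
suff comm : Pi \o Phi =1 F \o Pi by split; last exact/interprets_with_inclusionP.
move=> w; apply: (crt_inj hm) => i; rewrite (crt_padic_prod_red hm) /= FE /=.
rewrite (crt_invK hm) /prod_map (crt_padic_prod_red hm).
exact: phiE.
Qed.
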